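(* Let $G=NA$ be a finite Frobenius group with Frobenius kernel $N$ and Frobenius complement $A$. Then $\mathcal{CD}(G)=\mathcal{CD}(N)$ (equality of sets of subgroups of $G$, where $\mathcal{CD}(N)$ is the Chermak-Delgado lattice of $N$ considered as a group in its own right).
   Context: For a finite group $G$ and a subgroup $H\le G$, the Chermak-Delgado measure of $H$ in $G$ is $m_G(H)=|H|\,|C_G(H)|$, where $C_G(H)$ is the centralizer of $H$ in $G$. Put $m(G)=\max\{m_G(H)\mid H\le G\}$ and $\mathcal{CD}(G)=\{H\le G\mid m_G(H)=m(G)\}$; the set $\mathcal{CD}(G)$ is called the Chermak-Delgado lattice of $G$. An action of a group $A$ on a group $N$ (by automorphisms) is called Frobenius if $n^a\neq n$ whenever $n\in N$ and $a\in A$ are nonidentity elements. A finite group $G$ is a Frobenius group with Frobenius kernel $N$ and Frobenius complement $A$ if $N$ is a nontrivial normal subgroup of $G$, $A$ is a nontrivial complement for $N$ in $G$ (that is, $G=NA$ and $N\cap A=1$), and the conjugation action of $A$ on $N$ is Frobenius. Equivalently (given that $N$ is a nontrivial normal subgroup with nontrivial complement $A$), any one of the following holds: $A\cap A^g=1$ for all $g\in G\setminus A$; $C_G(a)\le A$ for all nonidentity $a\in A$; $C_G(n)\le N$ for all nonidentity $n\in N$. *)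

(* Defs.v *)
From mathcomp Require Import all_boot all_fingroup all_solvable.

Set Implicit Arguments.
Unset Strict Implicit.
Unset Printing Implicit Defensive.

Local Open Scope group_scope.

Definition cd_measure (gT : finGroupType) (G H : {group gT}) : nat :=
  (#|H| * #|'C_G(H)|)%N.

Definition cd_max (gT : finGroupType) (G : {group gT}) : nat :=
  \max_(H : {group gT} | H \subset G) cd_measure G H.

(* Subgroups of every G : {group gT} live in the same type {group gT}, so the
   lattices of G and of a subgroup N of G can be compared by plain equality;
   for N, both the measure and its maximum are computed inside N. *)
Definition cd_lattice (gT : finGroupType) (G : {group gT}) : {set {group gT}} :=
  [set H : {group gT} | (H \subset G) && (cd_measure G H == cd_max G)].

(* Main.v *)
Require Import Defs.
From mathcomp Require Import all_boot all_fingroup all_solvable.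
From mathcomp Require Import all_algebra all_character.

(** Write m(X) for the maximal Chermak-Delgado measure in X. The result reduces
   to the inequality |A| < |Z(N)|. Given it, |G| = |N||A| is smaller than
   |N||Z(N)| = m_N(N) <= m(N). If 1 < H <= N, then C_G(H) <= N, so that H has
   the same measure in G and in N. For the remaining H <= G the measure in G is
   at most |G|: this is clear for H = 1; and if H is not contained in N, then
   C_G(H) meets N trivially, so either C_G(H) = 1 and the measure is |H|, or
   the same remark applies to C_G(H) and both H and C_G(H) have order at most
   |A| < |N|. So only nontrivial subgroups of N can be members of either
   lattice, and there the two measures agree (Frobenius_cd_measure_ltn_max,
   Frobenius_cd_measure_ker).

   Since A acts semiregularly on Z(N), the inequality holds as soon as Z(N) is
   not trivial. This is where Thompson's theorem on Frobenius kernels is needed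
   (Frobenius_ker_nilpotent), and it cannot be bypassed: if N had trivial
   center and were, say, a direct product of nonabelian simple groups, then
   m(N) = |N| and the conclusion would fail. Most of the text proves that
   theorem.

   Let N be a Frobenius kernel all of whose proper sections that are invariant
   under a complement are nilpotent. If a minimal normal subgroup M of G inside
   N is proper, then M is an elementary abelian p-group, and every invariant
   Sylow subgroup of N for a prime other than p centralizes M
   (semiregular_fix_exp), so that N acts on M as a p-group and fixes a
   nontrivial element of it. If N is itself minimal and p is an odd prime
   divisor of |N|, then the normalizer of a nontrivial characteristic subgroup
   of a Sylow p-subgroup is N or nilpotent, and in the latter case p-nilpotent.
   Thompson's criterion Thompson_normal_p_complement then makes N p-nilpotent,
   which by minimality turns N into a p-group.

   Thompson's criterion starts from that of Frobenius: G is p-nilpotent if the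
   normalizers of all its nontrivial p-subgroups are. The latter hypothesis
   forces elements of a Sylow subgroup P that are conjugate in G to be
   conjugate in P, so the transfer to P / P' is a nontrivial power map on P.
   For Thompson's criterion, choosing a D that violates that of Frobenius with
   the p-part of |N_G(D)| maximal reduces the problem to a group with a
   nontrivial normal p-subgroup, then to the case where R = O_p(G) contains its
   centralizer in O_pp'(G) and G / R is p-nilpotent. There V = Ohm_1(Z(R)) is a
   faithful module for G / R, and some elementary abelian subgroup A of P of
   maximal rank acts nontrivially on an abelian p'-group E that is normalized
   by P / R, since otherwise the normalizer of the Thompson subgroup of P would
   not be p-nilpotent. Maximality of A makes its elements act quadratically on
   a suitable part of V, and quadratic action is incompatible with a nontrivial
   action on E when p is odd (quadratic_commutator, abelem_offender_cent). *)

Set Implicit Arguments.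
Unset Strict Implicit.
Unset Printing Implicit Defensive.

Local Open Scope group_scope.

(** * p-nilpotent groups *)

Definition p_nilpotent (gT : finGroupType) (p : nat) (G : {set gT}) :=
  p.-group (G / 'O_p^'(G)).

Section PNilpotent.

Variables (gT : finGroupType) (p : nat).
Implicit Types G H K P Q R D : {group gT}.

Lemma p_nilpotent_intro G K :
  K <| G -> p^'.-group K -> p.-nat #|G : K| -> p_nilpotent p G.
Proof.
move=> nsKG p'K; have [sKG _] := andP nsKG.
apply: pnat_dvd; rewrite card_quotient ?gFnorm // indexgS //.
exact: pcore_max.
Qed.

Lemma p_nilpotent_Hall G : p_nilpotent p G -> p^'.-Hall(G) 'O_p^'(G).
Proof.
rewrite /p_nilpotent /pHall pcore_sub pcore_pgroup /= pnatNK /pgroup.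
by rewrite card_quotient ?gFnorm.
Qed.

Lemma p_nilpotent_mul G P :
  p_nilpotent p G -> p.-Sylow(G) P -> 'O_p^'(G) * P = G.
Proof.
move/p_nilpotent_Hall=> hallK sylP.
suffices /sdprodP[]: 'O_p^'(G) ><| P = G by [].
by apply/sdprod_Hall_pcoreP; rewrite ?pHallNK.
Qed.

Lemma p_nilpotentS G H : H \subset G -> p_nilpotent p G -> p_nilpotent p H.
Proof.
move=> sHG /p_nilpotent_Hall hallK.
have nsKG := pcore_normal p^' G.
have hallKH := setI_normal_Hall nsKG hallK sHG.
have [_ p'KH] := and3P hallKH; rewrite pnatNK => pHK.
apply: p_nilpotent_intro p'KH pHK.
by rewrite /= setIC (normalGI sHG nsKG).
Qed.

End PNilpotent.

Section PNilpotentLocal.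

Variables (gT : finGroupType) (p : nat).
Implicit Types G H K P Q R D : {group gT}.

Lemma p_nilpotent_quotient G R :
  G \subset 'N(R) -> p_nilpotent p G -> p_nilpotent p (G / R).
Proof.
move=> nRG /p_nilpotent_Hall hallK; have [_ p'K] := and3P hallK.
rewrite pnatNK => pGK; have nsKG := pcore_normal p^' G.
have sKG := normal_sub nsKG.
apply: (@p_nilpotent_intro _ p (G / R)%G ('O_p^'(G) / R)%G).
- exact: quotient_normal.
- exact: quotient_pgroup.
exact: morphim_p_index (subset_trans sKG nRG) pGK.
Qed.

Lemma p_nilpotent_cent_pcore G R :
  R <| G -> p.-group R -> 'O_p^'(G) \subset 'C(R).
Proof.
move=> /andP[sRG nRG] pR.
have co: coprime #|R| #|'O_p^'(G)| := pnat_coprime pR (pcore_pgroup _ _).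
rewrite centsC (sameP commG1P trivgP) -(coprime_TIg co) subsetI.
rewrite commg_subl commg_subr (subset_trans (pcore_sub _ _)) //.
exact: subset_trans sRG (gFnorm _ _).
Qed.

Lemma p_nilpotent_cent_Sylow G P R : p_nilpotent p G -> p.-Sylow(G) P ->
  R <| G -> p.-group R -> 'C_G(R) * P = G.
Proof.
move=> nilG sylP nsRG pR; apply/eqP; rewrite eqEsubset mul_subG ?subsetIl //=.
  rewrite -{1}(p_nilpotent_mul nilG sylP) mulSg // subsetI pcore_sub.
  exact: p_nilpotent_cent_pcore.
exact: pHall_sub sylP.
Qed.

(** * Frobenius' normal p-complement theorem *)

Definition local_p_nilpotent G :=
  forall D, D \subset G -> p.-group D -> D :!=: 1 -> p_nilpotent p 'N_G(D).

(** Downward induction on the order of D = P :&: Q.  The normalizer N_G(D) is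
   p-nilpotent, so its Sylow subgroups are conjugate under C_G(D).  Sylow
   subgroups T1 and T2 of it that contain N_P(D) and N_Q(D) link P to Q through
   Sylow subgroups of G, consecutive ones being conjugate under C_G(D) or having
   an intersection larger than D. *)
Lemma Sylow_conj_cent_meet G P Q :
    local_p_nilpotent G -> p.-Sylow(G) P -> p.-Sylow(G) Q ->
  exists2 x, x \in 'C_G(P :&: Q) & Q :=: P :^ x.
Proof.
move=> nilG; have [n] := ubnP (#|G| - #|P :&: Q|).
elim: n => // n IHn in P Q *; rewrite ltnS => leGn sylP sylQ.
have [[sPG pP _] [sQG pQ _]] := (and3P sylP, and3P sylQ).
pose D := (P :&: Q)%G; rewrite -[P :&: Q]/(gval D) in leGn *.
have [trD | ntD] := eqVneq (D : {set gT}) 1.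
  have [x Gx defQ] := Sylow_trans sylP sylQ.
  by exists x; rewrite // trD inE Gx cent1T inE.
have [sDP sDQ] : D \subset P /\ D \subset Q by rewrite subsetIl subsetIr.
have sDG := subset_trans sDP sPG.
have [eqDP | neqDP] := eqVneq (D : {set gT}) P.
  exists 1; rewrite ?group1 // conjsg1.
  apply: (sub_pHall sylP pQ); rewrite // -eqDP //.
have neqDQ: D != Q :> {set gT}.
  apply: contra neqDP => /eqP eqDQ.
  by rewrite eqEcard sDP (card_Hall sylP) -(card_Hall sylQ) eqDQ /=.
have nilN : p_nilpotent p 'N_G(D) by apply: nilG => //; apply: pgroupS pP.
have ltD (X : {group gT}) : p.-group X -> D \subset X ->
  D != X :> {set gT} -> #|D| < #|'N_X(D)|.
  move=> pX sDX neqDX.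
  have ltDX: D \proper X by rewrite properEneq neqDX sDX.
  exact: proper_card (nilpotent_proper_norm (pgroup_nil pX) ltDX).
have [T1 sylT1 sPT1] :=
  Sylow_superset (setSI _ sPG) (pgroupS (subsetIl P 'N(D)) pP).
have [T2 sylT2 sQT2] :=
  Sylow_superset (setSI _ sQG) (pgroupS (subsetIl Q 'N(D)) pQ).
have [sT1G sT2G]: T1 \subset G /\ T2 \subset G.
  by split; [apply: subset_trans (pHall_sub sylT1) _ |
             apply: subset_trans (pHall_sub sylT2) _]; apply: subsetIl.
have nsDN: D <| 'N_G(D) by rewrite normalSG.
have cN := p_nilpotent_cent_Sylow nilN sylT1 nsDN (pgroupS sDP pP).
(* Write the conjugating element as t * c with t in T1: only c, which
   centralizes D, matters. *)
have [c cDc defT2]: exists2 c, c \in 'C_G(D) & T2 :=: T1 :^ c.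
  have [z Nz ->] := Sylow_trans sylT1 sylT2.
  move: Nz; rewrite -[in z \in _]cN -normC.
    case/mulsgP=> t c T1t /setIP[/setIP[Gc _] cc] ->.
    by exists c; rewrite ?inE ?Gc // conjsgM (conjGid T1t).
  rewrite (subset_trans (pHall_sub sylT1)) // normsI ?normG //.
  by rewrite (subset_trans _ (cent_norm _)) ?subsetIr.
have [P1 sylP1 sT1P1] := Sylow_superset sT1G (pHall_pgroup sylT1).
have [Gc cDc'] := setIP cDc.
have sNPD: 'N_P(D) \subset P :&: P1.
  by rewrite subsetI subsetIl (subset_trans sPT1).
have leC (X Y : {group gT}) : D \subset X :&: Y ->
  'C_G(X :&: Y) \subset 'C_G(D).
  by move=> sD; rewrite setIS ?centS.
have sub_lt (X Y Z : {group gT}) :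
    #|D| < #|'N_X(D)| -> 'N_X(D) \subset Y :&: Z ->
  Y \subset G -> #|G| - #|Y :&: Z| < n.
  move=> lt1 le1 sYG; apply: leq_trans leGn; apply: ltn_sub2l.
    apply: leq_trans lt1 _; apply: leq_trans (subset_leq_card le1) _.
    by rewrite subset_leq_card ?subIset ?sYG.
  exact: leq_trans lt1 (subset_leq_card le1).
(* N_P(D) lies in P :&: P1 and N_Q(D) in P1 :^ c :&: Q; both exceed D. *)
have [a cPa defP1] : exists2 a, a \in 'C_G(P :&: P1) & P1 :=: P :^ a.
  by apply: IHn => //; apply: (sub_lt P); rewrite ?ltD.
have sylP1c: p.-Sylow(G) (P1 :^ c) by rewrite pHallJ.
have sNQ: 'N_Q(D) \subset P1 :^ c :&: Q.
  by rewrite subsetI subsetIl andbT (subset_trans sQT2) // defT2 conjSg.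
have [b cQb defQ] : exists2 b, b \in 'C_G(P1 :^ c :&: Q) & Q :=: (P1 :^ c) :^ b.
  apply: (IHn (P1 :^ c)%G) => //; apply: (sub_lt Q); rewrite ?ltD //.
  exact: pHall_sub sylP1c.
have sDN (X : {group gT}): D \subset X -> D \subset 'N_X(D).
  by move=> sDX; rewrite subsetI sDX normG.
exists (a * c * b); last by rewrite defQ defP1 -!conjsgM mulgA.
have cDa: a \in 'C_G(D).
  by apply: (subsetP (leC P P1 _) a cPa); apply: subset_trans (sDN P sDP) sNPD.
have cDb: b \in 'C_G(D).
  apply: (subsetP (leC (P1 :^ c)%G Q _) b cQb).
  exact: subset_trans (sDN Q sDQ) sNQ.
by rewrite !groupM.
Qed.

(** P controls its own fusion: the two Sylow subgroups P and P :^ y^-1 contain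
   x, so some c centralizing x carries the first to the second, and c * y lies
   in N_G(P), which is the product of the centralizer of P and P. *)
Lemma local_p_nilpotent_fusion G P x y :
    local_p_nilpotent G -> p.-Sylow(G) P -> P :!=: 1 ->
    x \in P -> y \in G -> x ^ y \in P ->
  exists2 z, z \in P & x ^ y = x ^ z.
Proof.
move=> nilG sylP ntP Px Gy Pxy; have [sPG pP _] := and3P sylP.
have sylPy: p.-Sylow(G) (P :^ y^-1) by rewrite pHallJ ?groupV.
have [c /setIP[Gc cDc] defPy] := Sylow_conj_cent_meet nilG sylP sylPy.
have cxc: x ^ c = x.
  apply/conjg_fixP/commgP/esym/(centP cDc).
  by rewrite inE Px mem_conjg invgK.
have: c * y \in 'N_G(P).
  by rewrite inE groupM // inE conjsgM -defPy conjsgKV subxx.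
have nilN: p_nilpotent p 'N_G(P) by apply: nilG.
have sylPN: p.-Sylow('N_G(P)) P by rewrite Sylow_subnorm.
have nsPN: P <| 'N_G(P) by rewrite normalSG.
rewrite -(p_nilpotent_cent_Sylow nilN sylPN nsPN pP).
case/mulsgP=> u z /setIP[_ cPu] Pz defcy; exists z => //.
rewrite -{1}cxc -conjgM defcy conjgM; congr (_ ^ _).
by apply/conjg_fixP/commgP/esym/(centP cPu).
Qed.

End PNilpotentLocal.

(** The transfer V from G to P / P' sends g in P to the product of the images
   of conjugates of powers of g that lie in P. As P controls fusion, each
   factor is the image of the power itself, so V g is the image of g to the
   power |G : P|, which is coprime to p. Hence V does not vanish on P outside
   P'. *)
Lemma Sylow_fusion_quotient (gT : finGroupType) (p : nat) (G P : {group gT}) :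
    p.-Sylow(G) P -> P :!=: 1 ->
    {in P & G, forall x y, x ^ y \in P -> exists2 z, z \in P & x ^ y = x ^ z} ->
  exists M : {group gT}, [/\ M <| G, M \proper G & p.-nat #|G : M|].
Proof.
move=> sylP ntP fusP; have [sPG pP p'GP] := and3P sylP.
have nP'P: P \subset 'N(P^`(1)) := der_norm 1 P.
pose f := restrm_morphism nP'P (coset_morphism P^`(1)).
have abf: abelian (f @* P).
  by rewrite morphim_restrm setIid; apply: der_abelian 0 P.
pose V := transfer_morphism G abf.
have index_ker: #|G : 'ker V| = #|V @* G|.
  by rewrite card_morphim setIid.
have nsMG: 'ker V <| G := ker_normal V.
exists ('ker V)%G; split=> //.
  rewrite properEneq normal_sub // andbT.
  have ltP'P: P^`(1) \proper P.
    by rewrite (sol_der1_proper (pgroup_sol pP)).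
  have [_ [g Pg P'g]] := properP ltP'P.
  have Gg := subsetP sPG g Pg.
  apply/eqP => kerG; have: V g = 0%R by apply: (mker (f := V)); rewrite kerG.
  pose X := transversal (rcosets P G :* <[g]>) G.
  have trX: is_transversal X (rcosets P G :* <[g]>) G.
    exact/transversalP/rcosets_cycle_partition.
  pose n x := #|<[g]> : P :* x|.
  have XG x: x \in X -> x \in G by apply/subsetP/(transversal_sub trX).
  have Pgnx x: x \in X -> (g ^+ n x) ^ x^-1 \in P.
    by move=> Xx; rewrite conjgE invgK mulgA -mem_rcoset mulg_exp_card_rcosets.
  have fconj x : x \in X -> f ((g ^+ n x) ^ x^-1) = f g ^+ n x.
    move=> Xx; have Pgn: g ^+ n x \in P by apply: groupX.
    have [z Pz ->] := fusP _ _ Pgn (groupVr (XG x Xx)) (Pgnx x Xx).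
    rewrite morphJ // morphX //; apply/conjg_fixP/commgP/commute_sym/commuteX.
    by apply: (centsP abf); rewrite mem_morphim.
  have Afg m: f g ^+ m \in f @* P by rewrite groupX ?mem_morphim.
  rewrite /V /= (transfer_cycle_expansion sPG abf Gg trX).
  rewrite (eq_bigr (fun x => FiniteModule.fmod abf (f g) *+ n x)%R); last first.
    by move=> x Xx; rewrite -FiniteModule.fmodX ?(Afg 1%N) // -fconj.
  rewrite GRing.sumrMnr (sum_index_rcosets_cycle sPG Gg trX).
  rewrite -FiniteModule.fmodX ?(Afg 1%N) // => /(congr1 val).
  rewrite (FiniteModule.fmodK _ (Afg _)) /= => fg1.
  case/negP: P'g.
  apply: coset_idr; first exact: subsetP nP'P g Pg.
  apply/eqP; rewrite -[_ == 1]/(f g == 1) -order_eq1; apply/eqP.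
  rewrite (@pnat_1 p #[f g]) //; last by apply: pnat_dvd p'GP;
    rewrite order_dvdn fg1.
  exact: mem_p_elt (morphim_pgroup f pP) (Afg 1%N).
rewrite index_ker.
have cardF: #|[set: FiniteModule.fmod_of abf]| = #|f @* P|.
  rewrite -(card_imset _ (@FiniteModule.fmod_inj _ _ abf)); apply: eq_card => x.
  apply/imsetP/idP=> [[u _ ->] | fPx]; first exact: FiniteModule.fmodP.
  by exists (FiniteModule.fmod abf x);
    rewrite ?inE // (FiniteModule.fmodK _ fPx).
apply: pnat_dvd (morphim_pgroup f pP); rewrite -cardF.
exact: cardSg (subsetT (V @* G)).
Qed.

(** By induction the kernel M of the transfer has a normal p-complement, which
   is characteristic in M. *)
Theorem Frobenius_normal_p_complement (gT : finGroupType) (p : nat)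
    (G : {group gT}) :
  local_p_nilpotent p G -> p_nilpotent p G.
Proof.
have [n] := ubnP #|G|; elim: n G => // n IHn G /ltnSE leGn nilG.
have [P sylP] := Sylow_exists p G; have [sPG pP p'GP] := and3P sylP.
have [P1 | ntP] := eqsVneq P 1.
  apply: (@p_nilpotent_intro _ p _ G); rewrite ?normal_refl ?indexgg //.
  by rewrite /pgroup -indexg1 -P1.
have fusP: {in P & G, forall x y, x ^ y \in P ->
  exists2 z, z \in P & x ^ y = x ^ z}.
  by move=> x y Px Gy; apply: local_p_nilpotent_fusion sylP ntP Px Gy.
have [M [nsMG ltMG pGM]] := Sylow_fusion_quotient sylP ntP fusP.
have sMG := proper_sub ltMG.
have nilM: p_nilpotent p M.
  apply: IHn; first exact: leq_trans (proper_card ltMG) leGn.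
  move=> D sDM pD ntD; apply: p_nilpotentS (setSI _ sMG) _.
  by apply: nilG => //; apply: subset_trans sMG.
have [sKM p'K] := and3P (p_nilpotent_Hall nilM); rewrite pnatNK => pMK.
apply: (@p_nilpotent_intro _ p _ 'O_p^'(M)%G) => //.
  exact: gFnormal_trans.
by rewrite -(Lagrange_index sMG sKM) pnatM pGM.
Qed.

(** * Coprime and quadratic action on an abelian group *)

Section Quadratic.

Variables (gT : finGroupType).
Implicit Types V Y M : {group gT}.

(** If f fixes u = [~ v, f], then v ^ (f ^+ k) = v * u ^+ k: a unipotent element
   that acts with order prime to |V| acts trivially. *)
Lemma coprime_exp_fix V v f m :
    v \in V -> f \in 'N(V) -> commute f [~ v, f] ->
  coprime #|V| m -> v ^ (f ^+ m) = v -> v ^ f = v.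
Proof.
move=> Vv nVf cfu coVm fixm; set u := [~ v, f] in cfu.
have vf: v ^ f = v * u by rewrite /u commgEl mulKVg.
have Vu: u \in V by rewrite /u commgEl groupM ?groupV ?memJ_norm.
have uf: u ^ f = u by apply/conjg_fixP/commgP/commute_sym.
have vfk k: v ^ (f ^+ k) = v * u ^+ k.
  elim: k => [|k IHk]; first by rewrite conjg1 mulg1.
  by rewrite expgSr conjgM IHk conjMg conjXg uf vf -mulgA expgS.
have um: u ^+ m = 1 by apply: (mulgI v); rewrite -vfk mulg1.
suffices u1: u = 1 by rewrite vf u1 mulg1.
by rewrite -(expgK coVm Vu) um expg1n.
Qed.

(** A form of Thompson's A x B lemma in which f and Y only need to commute in
   their action on V, and f only needs to act with p'-order.  If f moved V, then
   Y would fix a nontrivial coset of C_V[f], and for v in this coset [~ v, f]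
   would be fixed by Y, hence by f. *)
Lemma coprime_cent_fixed (p : nat) V Y f m :
    p.-group V -> abelian V -> p.-group Y -> Y \subset 'N(V) -> f \in 'N(V) ->
    {in Y, forall y, [~ f, y] \in 'C(V)} -> p^'.-nat m -> f ^+ m \in 'C(V) ->
  'C_V(Y) \subset 'C[f] -> V \subset 'C[f].
Proof.
move=> pV cVV pY nVY nVf cfY p'm cfm sWf.
pose D := 'C_V[f]%G; have sDV: D \subset V by apply: subsetIl.
have nDY: Y \subset 'N(D).
  apply/subsetP=> y Yy; rewrite inE;
    apply/subsetP=> _ /imsetP[v /setIP[Vv cfv] ->].
  have nVy := subsetP nVY y Yy; have Vvy: v ^ y \in V by rewrite memJ_norm.
  rewrite inE Vvy; apply/cent1P/commgP/conjg_fixP.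
  have ->: (v ^ y) ^ f = ((v ^ f) ^ y) ^ [~ f, y]^-1.
    by rewrite -!conjgM ?mulgA (commgC f y) mulgK.
  rewrite invg_comm.
  have -> : v ^ f = v by apply/conjg_fixP/commgP/cent1P.
  apply/conjg_fixP/commgP/commute_sym; apply: (centP _ _ Vvy).
  by rewrite -invg_comm groupV cfY.
apply: contraT => nsVf.
have ltDV: ~~ (V \subset D) by rewrite subsetI subxx.
pose T := (V <*> Y)%G.
have nVT: T \subset 'N(V) by rewrite join_subG normG.
have pT: p.-group T by rewrite /= norm_joinEr // pgroupM pV.
have nDT: T \subset 'N(D) by rewrite join_subG nDY andbT sub_abelian_norm.
have nsVT: V / D <| T / D by rewrite quotient_normal // /normal joing_subl.
have: V / D :&: 'Z(T / D) != 1.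
  apply: (meet_center_nil (pgroup_nil (quotient_pgroup D pT)) nsVT).
  by rewrite -subG1 quotient_sub1 // (subset_trans (joing_subl _ _) nDT).
case/trivgPn=> _ /setIP[/morphimP[v nDv Vv ->] /setIP[_ cTv]] ntv.
have nDv' : v \notin 'C[f].
  by apply: contra ntv => cfv; apply/eqP/coset_id; rewrite inE Vv.
case/negP: nDv'; apply/cent1P/commgP/conjg_fixP.
have Vu: [~ v, f] \in V by rewrite commgEl groupM ?groupV ?memJ_norm.
apply: (coprime_exp_fix Vv nVf) (pnat_coprime pV p'm) _; last first.
  by apply/conjg_fixP/commgP; apply: commute_sym; apply: (centP cfm).
apply/cent1P; rewrite cent1C; apply: (subsetP sWf); rewrite inE Vu /=.
apply/centP=> y Yy; apply/commgP/conjg_fixP.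
have nVy := subsetP nVY y Yy.
have Ty: y \in T by apply: subsetP Yy; apply: joing_subr.
have Dd: [~ v, y] \in D.
  apply: coset_idr; first by rewrite groupR // (subsetP nDT).
  have nDy := subsetP nDT y Ty.
  rewrite morphR ?nDv ?nDy //; apply/eqP/commgP/(centP cTv).
  by rewrite mem_quotient.
have [Vd cfd] := setIP Dd; set d := [~ v, y] in Dd Vd cfd.
have vy: v ^ y = v * d by rewrite /d commgEl mulKVg.
have df : d ^ f = d by apply/conjg_fixP/commgP/cent1P.
have Vvf: v ^ f \in V by rewrite memJ_norm.
rewrite conjRg commgEl vy.
have ->: (v * d) ^ (f ^ y) = v ^ f * d.
  rewrite -[f ^ y](mulKVg f) -commgEl conjgM (conjMg v d f) df.
  apply/conjg_fixP/commgP/commute_sym.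
  by apply: (centP (cfY y Yy)); rewrite groupM.
rewrite invMg mulgA -(mulgA d^-1) -commgEl -(centsP cVV _ Vu) ?groupV //.
by rewrite mulgKV.
Qed.

Import FiniteModule GRing.Theory.
Local Notation "u ^@ x" := (actr u x) (at level 31, left associativity).

(** Let M act on V as an abelian group, and let x normalize M and satisfy
   (x - 1)^2 = 0 on V, that is, x^2 = 2x - 1.  Every conjugate x f, with
   f = [~ x, m0], satisfies the same equation, and substituting that of x gives
   2 x f' f - f' f = 2 x f - 1 with f' = f ^ x.  Conjugating this by an n in M
   with x ^ n = x f' changes only x, into x f'; the difference of the two
   equations is 2 x (f' - 1)(f' - 1) f = 0.  As 2, x and f are invertible on V,
   the element f' = [~ x, m0 ^ x] is again quadratic. *)
Lemma quadratic_commutator V M x :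
    abelian V -> odd #|V| -> x \in 'N(V) -> M \subset 'N(V) -> x \in 'N(M) ->
    [~: M, M] \subset 'C(V) -> {in V, forall v, commute x [~ v, x]} ->
  {in M & V, forall m v, commute [~ x, m] [~ v, [~ x, m]]}.
Proof.
move=> cVV oddV nVx nVM nMx cMM quadx m v Mm Vv.
(* Every m in M is m0 ^ x; f' is then a conjugate of f = [~ x, m0]. *)
have [m0 Mm0 ->{m Mm}]: exists2 m0, m0 \in M & m = m0 ^ x.
  by exists (m ^ x^-1); rewrite ?conjgKV // memJ_norm ?groupV.
have Mm: m0 ^ x \in M by rewrite memJ_norm.
have [f deff]: exists f, f = [~ x, m0] by exists [~ x, m0].
have [f' deff']: exists f', f' = f ^ x by exists (f ^ x).
have deff'2 : [~ x, m0 ^ x] = f'.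
  by rewrite deff' deff conjRg (_ : x ^ x = x) // conjgE mulKg.
rewrite deff'2.
have Mf: f \in M by rewrite deff commgEr groupM // memJ_norm ?groupV.
have Mf': f' \in M by rewrite deff' memJ_norm.
have nVm y: y \in M -> y \in 'N(V) by apply: subsetP.
have [nVf nVf'] := (nVm _ Mf, nVm _ Mf').
have cV (u : fmod_of cVV) c : c \in 'C(V) -> u ^@ c = u.
  move=> cc; apply: val_inj; rewrite fmvalJ ?(subsetP (cent_sub V)) //.
  by apply/conjg_fixP/commgP/commute_sym/(centP cc)/fmodP.
have actC (u : fmod_of cVV) a b : a \in M -> b \in M ->
  u ^@ a ^@ b = u ^@ b ^@ a.
  move=> Ma Mb; have [nVa nVb] := (nVm _ Ma, nVm _ Mb).
  rewrite -!actrM // (commgC a b) [LHS]actrM ?groupM ?groupV //.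
  by rewrite [LHS]cV // (subsetP cMM) // mem_commg.
have quad (u : fmod_of cVV) : (u ^@ x ^@ x = u ^@ x *+ 2 - u)%R.
  have Vu := fmodP u.
  have Vux : val u ^ x \in V by rewrite memJ_norm.
  suffices: ((u ^@ x - u) ^@ x = u ^@ x - u)%R.
    rewrite actAr actNr => /(canRL (subrK _)) ->.
    by rewrite mulr2n addrAC.
  apply: val_inj; rewrite fmvalJ // fmvalA fmvalN fmvalJ //.
  rewrite -(centsP cVV _ (groupVr Vu) _ Vux) -commgEl.
  by apply/conjg_fixP/commgP/commute_sym/quadx.
(* The equation for x * f, simplified by the equation for x. *)
have quadf (u : fmod_of cVV) :
  (u ^@ x ^@ f' ^@ f *+ 2 - u ^@ f' ^@ f = u ^@ x ^@ f *+ 2 - u)%R.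
  have nVf0 : m0 \in 'N(V) by apply: nVm.
  have defxf : x * f = x ^ m0 by rewrite deff commgEl mulKVg.
  have: (u ^@ (x ^ m0) ^@ (x ^ m0) = u ^@ (x ^ m0) *+ 2 - u)%R.
    have nVm0V : m0^-1 \in 'N(V) by rewrite groupV.
    have actJ (w : fmod_of cVV) : w ^@ (x ^ m0) = w ^@ m0^-1 ^@ x ^@ m0.
      by rewrite /conjg !actrM ?groupM.
    by rewrite !actJ actrK quad actAr actNr actZr actrKV.
  rewrite -defxf !actrM //.
  have ->: (u ^@ x ^@ f ^@ x ^@ f = u ^@ x ^@ x ^@ f' ^@ f)%R.
    by congr (_ ^@ _); rewrite -!actrM ?groupM // deff' -?mulgA -conjgC ?mulgA.
  by rewrite quad actAr actNr actZr actAr actNr actZr.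
(* The difference with the conjugate by n. *)
have quadff (u : fmod_of cVV) : (u ^@ f' ^@ f' = u ^@ f' *+ 2 - u)%R.
  have [n Mn defxn]: exists2 n, n \in M & x * f' = x ^ n.
    by exists (m0 ^ x); rewrite // -deff'2 commgEl mulKVg.
  have nVn : n \in 'N(V) by apply: nVm.
  pose t := u ^@ x^-1.
  have tx : (t ^@ x = u)%R by rewrite /t actrKV.
  have A := quadf t; rewrite tx in A.
  have tnx : (t ^@ n^-1 ^@ x ^@ n = u ^@ f')%R.
    by rewrite -tx -[RHS]actrM // defxn conjgE !actrM ?groupM ?groupV.
  have := congr1 (fun w => w ^@ n) (quadf (t ^@ n^-1)).
  rewrite !(actAr, actNr, actZr).
  rewrite (actC _ f n) // (actC _ f' n) // tnx.
  rewrite (actC (t ^@ n^-1 ^@ f') f n) // (actC (t ^@ n^-1) f' n) // actrKV.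
  rewrite (actC _ f n) // tnx => B.
  have two_inj (w : fmod_of cVV) : (w *+ 2 = 0 -> w = 0)%R.
    move=> w2; have co2 : coprime #|V| 2 by rewrite coprimen2.
    by apply: val_inj; rewrite -(expgK co2 (fmodP w)) -fmvalZ w2 /= expg1n.
  apply/eqP; rewrite -subr_eq0; apply/eqP.
  apply: (can_inj (actrK f)); rewrite act0r; apply: two_inj.
  rewrite !(actAr, actNr, actZr) -/(_ + _)%R.
  move: A B; set a := (u ^@ f' ^@ f' ^@ f)%R; set b := (u ^@ f' ^@ f)%R.
  set c := (u ^@ f)%R; set d := (t ^@ f' ^@ f)%R.
  have subKK (p q r : fmod_of cVV) : (p - r - (q - r) = p - q)%R.
    by rewrite opprB addrA subrK.
  move=> A B; have e: (a *+ 2 - b *+ 2 = b *+ 2 - c *+ 2)%R.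
    by rewrite -(subKK _ _ d) A B subKK.
  rewrite opprB mulrnDl mulrnBl addrCA (canRL (subrK _) e) mulr2n.
  by rewrite (mulr2n (b *+ 2)) (addrAC (b *+ 2)%R) addrAC subrr sub0r subrr.
have uv := fmodK cVV Vv; move: (quadff (fmod cVV v)) => quadv.
have Vvf': v ^ f' \in V by rewrite memJ_norm.
suffices: ((fmod cVV v ^@ f' - fmod cVV v) ^@ f' =
           fmod cVV v ^@ f' - fmod cVV v)%R.
  move/(congr1 val); rewrite fmvalJ // fmvalA fmvalN fmvalJ // fmodK //.
  rewrite -(centsP cVV _ (groupVr Vv) _ Vvf') -commgEl => fixf'.
  by apply/commute_sym/commgP/conjg_fixP.
by rewrite actAr actNr quadv mulr2n addrAC addrK.
Qed.

End Quadratic.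

(** Take for D a minimal A-invariant subgroup of [~: E, A], where A has no fixed
   points.  Then D is an irreducible module for the abelian group A, so the
   quotient of A by B = C_A(D) is cyclic, hence of order p. *)
Lemma abelem_irr_cent (gT : finGroupType) (p : nat) (A E : {group gT}) :
    p.-abelem A -> A \subset 'N(E) -> coprime #|E| #|A| -> abelian E ->
    ~~ (A \subset 'C(E)) ->
  exists D B : {group gT},
    [/\ D \subset E, A \subset 'N(D), ~~ (A \subset 'C(D)),
        B \subset A & (B \subset 'C(D)) /\ #|A| = (p * #|B|)%N].
Proof.
move=> abelA nEA coEA cEE ncEA; have [pA cAA _] := and3P abelA.
pose W := [~: E, A]%G; have sWE: W \subset E by rewrite commg_subl.
have ntW: W :!=: 1 by apply: contra ncEA => /eqP/commG1P; rewrite centsC.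
have nWA: A \subset 'N(W) by rewrite commg_normr.
have [D minD sDW]: {D : {group gT} | minnormal D A & D \subset W}.
  by apply: mingroup_exists; rewrite ntW.
have sDE := subset_trans sDW sWE.
have [nDA ntD abelD] := minnormal_solvable minD sDE (abelian_sol cEE).
have ncDA: ~~ (A \subset 'C(D)).
  apply: contra ntD; rewrite centsC => cDA; rewrite -subG1.
  by rewrite -(coprime_abel_cent_TI nEA coEA cEE) subsetI sDW.
have [q q_pr abelqD] := is_abelemP abelD.
exists D, 'C_A(D)%G; split; rewrite ?subsetIl //; split; first exact: subsetIr.
have irr: mx_irreducible (abelem_repr abelqD ntD nDA) by apply/abelem_mx_irrP.
have := center_kquo_cyclic irr; rewrite rker_abelem.
have cAAq: abelian (A / 'C_A(D)) by rewrite quotient_abelian.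
rewrite (center_idP cAAq) => cycAq.
have nCA: A \subset 'N('C_A(D)) by rewrite normsI ?normG // norms_cent.
have := cyclic_abelem_prime (quotient_abelem _ abelA) cycAq.
rewrite -subG1 quotient_sub1 // subsetI subxx => /(_ ncDA) <-.
by rewrite mulnC card_quotient // Lagrange ?subsetIl.
Qed.

(** Suppose that A acts nontrivially on E, and take D and B in A / R as in
   abelem_irr_cent, with preimages M and Y.  Put W = C_V(Y).  As Y W is
   elementary abelian, its order is at most |A| = p |Y|, so C_V(A), which
   contains Y :&: W, has index at most p in W.  Hence [W, A] <= C_V(A), and all
   elements of A are quadratic on W.  For x in A and m in M, the commutator
   [~ x, m] is then quadratic on W and acts there with p'-order, so it
   centralizes W, and by coprime_cent_fixed it centralizes V.  Thus A / R
   centralizes D, against the choice of D. *)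
Lemma abelem_offender_cent (gT : finGroupType)
    (p : nat) (G R V P A : {group gT}) (E : {group coset_of R}) :
    odd p -> R <| G -> p.-abelem V -> G \subset 'N(V) -> 'C_G(V) = R ->
    p.-group P -> P \subset G -> V \subset P -> A \in 'E_p^('r_p(P))(P) ->
    E \subset G / R -> abelian E -> p^'.-group E -> A / R \subset 'N(E) ->
  A / R \subset 'C(E).
Proof.
move=> p_odd nsRG abelV nVG defR pP sPG sVP /pnElemP[sAP abelA rA].
move=> sEG cEE p'E nEA.
have [sRG nRG] := andP nsRG; have [pA cAA _] := and3P abelA.
have [pV cVV _] := and3P abelV.
have sAG := subset_trans sAP sPG; have nRA := subset_trans sAG nRG.
have nVA := subset_trans sAG nVG.
have cVR: R \subset 'C(V) by rewrite -defR subsetIr.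
have coEA: coprime #|E| #|A / R|.
  by rewrite coprime_sym; apply: pnat_coprime p'E; apply: quotient_pgroup pA.
apply: contraT => ncEA.
have [D [B [sDE nDA ncDA sBA [cDB oA]]]] :=
  abelem_irr_cent (quotient_abelem R abelA) nEA coEA cEE ncEA.
have p'D := pgroupS sDE p'E; have cDD := abelianS sDE cEE.
pose Y := (A :&: coset R @*^-1 B)%G; pose M := (coset R @*^-1 D)%G.
have sYA: Y \subset A by apply: subsetIl.
have oAY: #|A| = (p * #|Y|)%N.
  have YR: Y :&: R = A :&: R.
    by rewrite -setIA; congr (_ :&: _); apply/setIidPr/(sub_cosetpre B).
  have qY : Y / R = B.
    by rewrite quotientIG ?sub_cosetpre // cosetpreK; apply/setIidPr.
  rewrite -(LagrangeI A R) -card_quotient // oA -(LagrangeI Y R) YR.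
  by rewrite -card_quotient ?(subset_trans sYA) // qY mulnCA.
have sMG: M \subset G.
  by rewrite -(quotientGK nsRG) morphpreS // (subset_trans sDE).
have nRM := subset_trans sMG nRG; have nVM := subset_trans sMG nVG.
have qM : M / R = D by rewrite cosetpreK.
have cYM: {in M & Y, forall m y, [~ m, y] \in R}.
  move=> m y /morphpreP[nRm Dm] /setIP[_ /morphpreP[nRy By]].
  apply: coset_idr; rewrite ?groupR ?morphR //; apply/eqP/commgP.
  exact/esym/(centsP cDB).
have fixV r v : r \in 'C(V) -> v \in V -> v ^ r = v.
  by move=> cr Vv; apply/conjg_fixP/commgP/commute_sym/(centP cr).
pose W := 'C_V(Y)%G; have sWV: W \subset V by apply: subsetIl.
have nVY: Y \subset 'N(V) := subset_trans sYA nVA.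
have nWM: M \subset 'N(W).
  apply/subsetP=> m Mm; rewrite inE;
    apply/subsetP=> _ /imsetP[w /setIP[Vw cYw] ->].
  have Vwm: w ^ m \in V by rewrite memJ_norm ?(subsetP nVM).
  rewrite inE Vwm; apply/centP=> y Yy; apply/commgP/conjg_fixP.
  have wy: w ^ y = w by apply/conjg_fixP/commgP/(centP cYw).
  rewrite -conjgM (commgC m y) (conjgM _ (y * m)) (conjgM w y m) wy.
  by apply: fixV; rewrite ?(subsetP cVR) ?cYM.
have nWA: A \subset 'N(W).
  by rewrite normsI // norms_cent // cents_norm // (subset_trans cAA) ?centS.
pose D1 := 'C_V(A)%G; have sD1W: D1 \subset W by rewrite setIS ?centS.
(* Here the maximality of the rank of A is used. *)
have leW: #|W| <= p * #|D1|.
  have cYW: W \subset 'C(Y) by apply: subsetIr.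
  have abelYW: p.-abelem (Y <*> W).
    by rewrite (cprod_abelem _ (cprodEY _)) // ?(abelemS sYA) ?(abelemS sWV).
  have sYWP: Y <*> W \subset P.
    by rewrite join_subG (subset_trans sYA) // (subset_trans sWV).
  have leYW: #|Y <*> W| <= #|A|.
    rewrite (card_pgroup (abelem_pgroup abelYW)) (card_pgroup pA).
    rewrite leq_pexp2l //; last by rewrite rA logn_le_p_rank // inE sYWP.
    exact: odd_gt0.
  have sYWD: Y :&: W \subset D1.
    rewrite subsetI (subset_trans (subsetIr _ _) sWV).
    by rewrite (subset_trans (subsetIl _ _)) // (subset_trans sYA).
  have eqYW: (#|Y| * #|W| = #|Y <*> W| * #|Y :&: W|)%N.
    by rewrite mul_cardG norm_joinEr // cents_norm.
  have: (#|Y| * #|W| <= #|Y| * (p * #|D1|))%N.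
    rewrite eqYW mulnCA mulnA -oAY leq_mul // subset_leq_card //.
  by rewrite leq_pmul2l.
(* A section of order at most p is centralized by every p-group. *)
have cWA: [~: W, A] \subset D1.
  have nDW: W \subset 'N(D1) by rewrite sub_abelian_norm // (abelianS sWV).
  have nDA1: A \subset 'N(D1) by rewrite cents_norm // centsC subsetIr.
  rewrite -quotient_cents2 //.
  have pW: p.-group W := pgroupS sWV pV.
  have [-> | ntWq] := eqsVneq (W / D1) 1; first exact: sub1G.
  pose T := (W <*> A)%G.
  have pT: p.-group T by rewrite /= norm_joinEr // pgroupM pW.
  have nDT: T \subset 'N(D1) by rewrite join_subG nDW.
  have [p_pr p_dv _] := pgroup_pdiv (quotient_pgroup D1 pW) ntWq.
  have prW: prime #|W / D1|.
    suffices -> : #|W / D1| = p by [].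
    apply/eqP; rewrite eqn_leq; apply/andP; split; last exact: dvdn_leq.
    by rewrite card_quotient // -divgS // leq_divLR ?cardSg.
  have nsWT: W / D1 <| T / D1.
    by rewrite quotient_normal // /normal joing_subl join_subG normG.
  have meetZ := meet_center_nil (pgroup_nil (quotient_pgroup D1 pT)) nsWT ntWq.
  have sWZ: W / D1 \subset 'Z(T / D1) by rewrite prime_meetG.
  apply: subset_trans sWZ (subset_trans (subsetIr _ _) _).
  by rewrite centS // quotientS // joing_subr.
case/negP: ncDA; apply/centsP=> _ /morphimP[x nRx Ax ->] d Dd.
have: d \in M / R by rewrite qM.
case/morphimP=> m nRm Mm ->; apply/commgP; rewrite -morphR //;
  apply/eqP/coset_id.
have nMx: x \in 'N(M).
  rewrite inE; apply/subsetP=> _ /imsetP[n /morphpreP[nRn Dn] ->].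
  apply/morphpreP; split; first by rewrite groupJ.
  by rewrite morphJ // memJ_norm // (subsetP nDA) // mem_quotient.
have nVx := subsetP nVA x Ax.
have Mf: [~ x, m] \in M by rewrite commgEr groupM // memJ_norm ?groupV.
have nVf := subsetP nVM _ Mf.
have RM f : f \in M -> f ^+ #|D| \in R.
  move=> Mf1; have nRf := subsetP nRM f Mf1.
  apply: coset_idr; first by rewrite groupX.
  by rewrite morphX //=; apply/eqP;
    rewrite -order_dvdn order_dvdG // -qM mem_quotient.
have cMM: [~: M, M] \subset 'C(W).
  apply: subset_trans (centS sWV); apply: subset_trans cVR.
  by rewrite -quotient_cents2 // qM.
have quadx: {in W, forall w, commute x [~ w, x]}.
  move=> w Ww; have /setIP[_ /centP]: [~ w, x] \in D1.
    by rewrite (subsetP cWA) // mem_commg.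
  by move/(_ x Ax)/commute_sym.
have pW := pgroupS sWV pV.
have cWf: W \subset 'C[[~ x, m]].
  apply/subsetP=> w Ww; apply/cent1P/commgP/conjg_fixP.
  apply: (coprime_exp_fix Ww (subsetP nWM _ Mf)) (pnat_coprime pW p'D) _.
    apply: (quadratic_commutator _ _ _ nWM) => //; first exact: abelianS cVV.
      exact: odd_pgroup_odd p_odd pW.
    exact: subsetP nWA x Ax.
  by apply: fixV; [apply: (subsetP cVR); apply: RM | apply: (subsetP sWV)].
rewrite -defR inE (subsetP sMG) //.
have : V \subset 'C[[~ x, m]].
  apply: coprime_cent_fixed pV cVV (pgroupS sYA pA) nVY nVf _ p'D _ cWf.
    move=> y Yy; apply: (subsetP cVR); exact: cYM.
  by apply: (subsetP cVR); apply: RM.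
by rewrite sub_cent1.
Qed.

(** * The Thompson subgroup *)

Definition Thompson_subgroup (gT : finGroupType) (p : nat) (P : {set gT}) :=
  <<\bigcup_(A in 'E_p^('r_p(P))(P)) A>>.

Canonical Thompson_subgroup_group (gT : finGroupType) (p : nat)
    (P : {set gT}) :=
  Eval hnf in [group of Thompson_subgroup p P].

Section ThompsonSubgroup.

Variables (gT : finGroupType) (p : nat).
Implicit Types P S A : {group gT}.
Local Notation J := (Thompson_subgroup p).

Lemma Thompson_subgroup_sub P : J P \subset P.
Proof. by rewrite gen_subG; apply/bigcupsP=> A /pnElemP[]. Qed.

Lemma sub_Thompson_subgroup P A : A \in 'E_p^('r_p(P))(P) -> A \subset J P.
Proof. by move=> EA; rewrite sub_gen // (bigcup_max A). Qed.

Lemma Thompson_subgroup_neq1 P : p.-group P -> P :!=: 1 -> J P != 1.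
Proof.
move=> pP ntP; have [A EA] := p_rank_witness p P.
have [_ _ dimA] := pnElemP EA.
apply: contraTneq (sub_Thompson_subgroup EA) => ->; rewrite subG1 -cardG_gt1.
have [p_pr p_dv _] := pgroup_pdiv pP ntP.
have: 0 < 'r_p(P) by rewrite p_rank_gt0 mem_primes p_pr cardG_gt0.
rewrite -dimA lognE; case: ifP => // /and3P[_ _ p_dvA] _.
by rewrite (leq_trans (prime_gt1 p_pr)) // dvdn_leq.
Qed.

(** This makes J P characteristic in every intermediate subgroup. *)
Lemma Thompson_subgroup_eq P S : J P \subset S -> S \subset P -> J S = J P.
Proof.
move=> sJS sSP; have [A EA] := p_rank_witness p P.
have sAS A1 : A1 \in 'E_p^('r_p(P))(P) -> A1 \subset S.
  by move=> EA1; apply: subset_trans (sub_Thompson_subgroup EA1) sJS.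
have eqr: 'r_p(S) = 'r_p(P).
  apply/eqP; rewrite eqn_leq p_rankS //=; apply/p_rank_geP; exists A.
  by have [_ abelA dimA] := pnElemP EA; apply/pnElemP; rewrite sAS.
rewrite /Thompson_subgroup eqr; congr <<_>>; apply: eq_bigl => B.
apply/pnElemP/idP=> [[sBS abelB dimB] | EB].
  by apply/pnElemP; rewrite (subset_trans sBS).
by have [_ abelB dimB] := pnElemP EB; rewrite sAS.
Qed.

Lemma Thompson_subgroup_char P : J P \char P.
Proof.
apply/charP; split=> [|f injf fP]; first exact: Thompson_subgroup_sub.
apply/eqP; rewrite eqEcard card_injm ?Thompson_subgroup_sub // leqnn andbT.
rewrite morphim_gen; last first.
  by apply/bigcupsP=> A /pnElemP[].
rewrite gen_subG; apply/subsetP=> _ /morphimP[x _ /bigcupP[A EA Ax] ->].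
have [sAP abelA dimA] := pnElemP EA.
suffices EfA: (f @* A)%G \in 'E_p^('r_p(P))(P).
  apply: subsetP (sub_Thompson_subgroup EfA) _ _; apply: mem_morphim => //.
  exact: subsetP sAP x Ax.
have sfAP: f @* A \subset P by rewrite (subset_trans (morphimS f sAP)) ?fP.
by apply/pnElemP; rewrite /= card_injm // morphim_abelem.
Qed.

End ThompsonSubgroup.

(** * Groups with O_p'(G) = 1 *)

Section Constrained.

Variables (gT : finGroupType) (p : nat) (G : {group gT}).
Local Notation R := 'O_p(G)%G.
Local Notation K := (coset 'O_p(G) @*^-1 'O_p^'(G / 'O_p(G)))%G.
Hypothesis Op'G1 : 'O_p^'(G) = 1.

Let qK : K / R = 'O_p^'(G / R). Proof. exact: cosetpreK. Qed.

Lemma pcore_p'core_normal : K <| G.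
Proof.
have nsRG : R <| G := pcore_normal p G.
by rewrite -[X in _ <| X](quotientGK nsRG) cosetpre_normal pcore_normal.
Qed.

(** Z(R) is a central Sylow p-subgroup of T = C_K(R), so T is the product of
   Z(R) and a normal p'-subgroup, which is trivial since O_p'(G) is. *)
Lemma cent_pcore_sub_p'core : 'C_K(R) \subset R.
Proof.
have nsRG : R <| G := pcore_normal p G; have [sRG nRG] := andP nsRG.
have nsKG := pcore_p'core_normal; have [sKG nKG] := andP nsKG.
set T := 'C_K(R)%G; have nsTG : T <| G.
  by rewrite /normal subIset ?sKG // normsI // norms_cent.
have [sTG nTG] := andP nsTG.
pose Z := (T :&: R)%G; have nsZT : Z <| T.
  by rewrite /normal subsetIl normsI ?normG // (subset_trans sTG).
have cZT : T \subset 'C(Z).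
  by rewrite (subset_trans (subsetIr _ _)) // centS ?subsetIr.
have pZ : p.-group Z := pgroupS (subsetIr _ _) (pcore_pgroup p G).
have p'TZ : p^'.-nat #|T : Z|.
  rewrite /= indexgI -card_quotient ?(subset_trans sTG) //.
  apply: pgroupS (pcore_pgroup p^' (G / R)).
  apply: subset_trans (_ : K / R \subset _); last by rewrite qK.
  exact/quotientS/subsetIl.
have hallZ : p.-Hall(T) Z by rewrite /pHall subsetIl pZ.
have /splitsP[U /complP[tiZU defT]] :=
  SchurZassenhaus_split (pHall_Hall hallZ) nsZT.
have sUT : U \subset T by rewrite -defT mulG_subr.
have p'U : p^'.-group U.
  have : U \in [complements to Z in T] by apply/complP.
  by rewrite (compl_pHall U hallZ) => /pHall_pgroup.
have nsUT : U <| T.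
  have: Z * U \subset 'N(U).
    by rewrite mul_subG ?normG // cents_norm // centsC (subset_trans sUT).
  by rewrite defT /normal sUT.
have sUO : U \subset 'O_p^'(G).
  apply: subset_trans (pcore_max p'U nsUT) (pcore_max (pcore_pgroup _ _) _).
  exact: gFnormal_trans.
move: sUO; rewrite Op'G1 => /trivgP U1.
by move: defT; rewrite U1 mulg1 => <-; apply: subsetIr.
Qed.

(** C_G(R) centralizes K / R modulo R by cent_pcore_sub_p'core, so the image of
   C_P(R) is normal in G / R = (K / R)(P / R), while O_p(G / R) = 1. *)
Lemma cent_pcore_sub_Sylow (P : {group gT}) :
  p_nilpotent p (G / R) -> p.-Sylow(G) P -> 'C_P(R) \subset R.
Proof.
move=> nilGR sylP; have nsRG : R <| G := pcore_normal p G.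
have [sRG nRG] := andP nsRG; have [sKG nKG] := andP pcore_p'core_normal.
have [sPG pP _] := and3P sylP; have nRP := subset_trans sPG nRG.
pose X := 'C_G(R)%G; have nsXG : X <| G.
  by rewrite /normal subsetIl normsI ?normG // norms_cent.
have [sXG nXG] := andP nsXG; have nRX := subset_trans sXG nRG.
have cXK : X / R \subset 'C('O_p^'(G / R)).
  rewrite -qK quotient_cents2 ?(subset_trans sKG) //.
  apply: subset_trans cent_pcore_sub_p'core; rewrite subsetI.
  rewrite commg_subr (subset_trans sXG nKG) /=.
  apply: subset_trans (_ : X \subset _); last exact: subsetIr.
  by rewrite commg_subl (subset_trans sKG nXG).
pose Y := (X / R :&: P / R)%G.
have nsYG : Y <| G / R.
  rewrite /normal subIset ?quotientS //=.
  rewrite -(p_nilpotent_mul nilGR (quotient_pHall nRP sylP)) mul_subG //.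
    by rewrite cents_norm // centsC subIset ?cXK.
  by rewrite normsI ?normG // (subset_trans (quotientS R sPG)) //
    quotient_norms.
have: Y \subset 'O_p(G / R).
  by rewrite pcore_max // (pgroupS (subsetIr _ _)) ?quotient_pgroup.
rewrite trivg_pcore_quotient subG1 => /eqP Y1.
rewrite -quotient_sub1 ?(subset_trans (subsetIl _ _)) // -Y1 subsetI.
by rewrite !quotientS ?subsetIl // setSI.
Qed.

(** Since Z(P) <= C_P(R) <= R, the group Ohm_1(Z(P)) is contained in
   Ohm_1(Z(R)), so the centralizer of the latter is p-nilpotent; being normal in
   G, it has no nontrivial p'-core and is a p-group. *)
Lemma cent_Ohm1_center_pcore (P : {group gT}) :
    p_nilpotent p (G / R) -> p.-Sylow(G) P ->
    p_nilpotent p 'N_G('Ohm_1('Z(P))) ->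
  'C_G('Ohm_1('Z(R))) = R.
Proof.
move=> nilGR sylP nilN; have nsRG : R <| G := pcore_normal p G.
have [sRG nRG] := andP nsRG; have [sPG pP _] := and3P sylP.
have sRP : R \subset P by rewrite pcore_sub_Hall.
have sZR : 'Z(P) \subset 'Z(R).
  have cZR : 'Z(P) \subset 'C(R) by rewrite subIset // centS // orbT.
  rewrite subsetI cZR andbT;
  apply: subset_trans (cent_pcore_sub_Sylow nilGR sylP).
  by rewrite subsetI cZR subsetIl.
have nsVG: 'Ohm_1('Z(R)) <| G by rewrite !gFnormal_trans.
set C := 'C_G('Ohm_1('Z(R)))%G; have nsCG : C <| G.
  by rewrite /normal subsetIl normsI ?normG // norms_cent // normal_norm.
have nilC : p_nilpotent p C.
  apply: p_nilpotentS nilN; rewrite setIS //.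
  by rewrite (subset_trans (centS (OhmS 1 sZR))) ?cent_sub.
have pC : p.-group C.
  have : 'O_p^'(C) \subset [1 gT].
    rewrite -Op'G1; apply: pcore_max (pcore_pgroup _ _) _.
    exact: gFnormal_trans.
  move/trivgP=> O1; move: nilC; rewrite /p_nilpotent O1.
  by rewrite pquotient_pgroup ?norms1 ?pgroup1.
apply/eqP; rewrite eqEsubset pcore_max //= subsetI sRG centsC.
by rewrite (subset_trans (Ohm_sub 1 _)) ?subsetIr.
Qed.

End Constrained.

(** * Thompson's normal p-complement theorem *)

(** Thompson's criterion is usually stated for the center and the Thompson
   subgroup of P only; this stronger hypothesis is just as easy to verify in a
   minimal Frobenius kernel. *)
Definition char_p_nilpotent (gT : finGroupType) (p : nat) (G : {group gT}) :=
  forall P C : {group gT}, p.-Sylow(G) P -> C \char P -> C :!=: 1 ->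
  p_nilpotent p 'N_G(C).

Lemma char_p_nilpotentS (gT : finGroupType) (p : nat) (G H P : {group gT}) :
    p.-Sylow(G) P -> P \subset H -> H \subset G ->
  char_p_nilpotent p G -> char_p_nilpotent p H.
Proof.
move=> sylP sPH sHG nilG S C sylS chC ntC.
have sylSG: p.-Sylow(G) S.
  rewrite pHallE (subset_trans (pHall_sub sylS)) //= (card_Hall sylS).
  by rewrite -(card_Hall (pHall_subl sPH sHG sylP)) (card_Hall sylP).
exact: p_nilpotentS (setSI _ sHG) (nilG S C sylSG chC ntC).
Qed.

(** P is isomorphic to its image in G / L, so characteristic subgroups of the
   image come from characteristic subgroups C of P, and by the Frattini argument
   the normalizer of the image of C is the image of N_G(C). *)
Lemma char_p_nilpotent_p'quotient (gT : finGroupType) (p : nat)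
    (G : {group gT}) :
  char_p_nilpotent p G -> char_p_nilpotent p (G / 'O_p^'(G)).
Proof.
set L := 'O_p^'(G)%G => nilG; have nsLG : L <| G := pcore_normal p^' G.
have [sLG nLG] := andP nsLG; have p'L : p^'.-group L := pcore_pgroup _ _.
move=> Pb Cb sylPb chC ntC.
have [P0 sylP0] := Sylow_exists p G.
have sylP0b := quotient_pHall (subset_trans (pHall_sub sylP0) nLG) sylP0.
have [xb] := Sylow_trans sylP0b sylPb.
case/morphimP=> x nLx Gx -> defPb; pose P := (P0 :^ x)%G.
have sylP : p.-Sylow(G) P by rewrite pHallJ.
have [sPG pP _] := and3P sylP; have nLP := subset_trans sPG nLG.
have {}defPb : Pb :=: P / L by rewrite defPb quotientJ.
have tiLP : L :&: P = 1.
  by rewrite setIC; apply: coprime_TIg (pnat_coprime pP p'L).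
pose C := (P :&: coset L @*^-1 Cb)%G.
have sCP : C \subset P by apply: subsetIl.
have qC : C / L = Cb.
  rewrite quotientIG ?sub_cosetpre // cosetpreK -defPb.
  by apply/setIidPr; apply: char_sub.
have injf : 'injm (restrm nLP (coset L)).
  by rewrite ker_restrm ker_coset setIC tiLP.
have chCP : C \char P.
  rewrite -(char_injm injf) // !morphim_restrm setIid (setIidPr sCP).
  by rewrite -!/(quotient _ _) qC -defPb.
have ntC' : C :!=: 1.
  by apply: contra ntC => /eqP C1; rewrite -qC C1 quotient1.
have nilN := nilG P C sylP chCP ntC'.
have nLN : 'N_G(C) \subset 'N(L) by rewrite subIset // nLG.
apply: p_nilpotentS (p_nilpotent_quotient nLN nilN).
pose CL := (L <*> C)%G; have sCG := subset_trans sCP sPG.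
have nLC := subset_trans sCG nLG.
have defCL : CL = L * C :> {set gT} by apply: norm_joinEr.
have nsL : L <| CL by rewrite /normal joing_subl join_subG normG.
have qCL : CL / L = Cb by rewrite defCL quotientMidl.
suffices: 'N_(G / L)(Cb) \subset 'N_G(C) / L by [].
have <- : 'N_G(CL) / L = 'N_(G / L)(Cb) by rewrite -qCL quotient_subnormG.
rewrite -(quotientMidl L 'N_G(C)) quotientS //.
have sCLG : CL \subset G by rewrite join_subG sLG.
have nsCL : CL <| 'N_G(CL) by rewrite normalSG.
have sylC : p.-Sylow(CL) C.
  have [] // := coprime_mulGp_Hall (esym defCL) p'L.
  exact: pgroupS sCP pP.
rewrite -{1}(Frattini_arg nsCL sylC) defCL -mulgA mulgS //.
by rewrite mul_subG ?setSI ?subsetIl // subsetI sCG normG.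
Qed.

(** The preimage C of a nontrivial characteristic subgroup of P / O_p(G) is
   normal in P but not in G, so N_G(C) is a proper subgroup containing P. *)
Lemma char_p_nilpotent_pcore_quotient (gT : finGroupType) (p : nat)
    (G : {group gT}) :
    (forall H : {group gT}, H \proper G -> char_p_nilpotent p H ->
      p_nilpotent p H) ->
  char_p_nilpotent p G -> char_p_nilpotent p (G / 'O_p(G)).
Proof.
set R := 'O_p(G)%G => IH nilG; have nsRG : R <| G := pcore_normal p G.
have [sRG nRG] := andP nsRG; have pR : p.-group R := pcore_pgroup p G.
move=> Pb Cb sylPb chC ntC.
have [P0 sylP0] := Sylow_exists p G.
have sylP0b := quotient_pHall (subset_trans (pHall_sub sylP0) nRG) sylP0.
have [xb] := Sylow_trans sylP0b sylPb.
case/morphimP=> x nRx Gx -> defPb; pose P := (P0 :^ x)%G.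
have sylP : p.-Sylow(G) P by rewrite pHallJ.
have [sPG pP _] := and3P sylP; have nRP := subset_trans sPG nRG.
have sRP : R \subset P by apply: pcore_sub_Hall.
have nsRP : R <| P by rewrite /normal sRP.
have {}defPb : Pb :=: P / R by rewrite defPb quotientJ.
pose C := (coset R @*^-1 Cb)%G; have qC : C / R = Cb := cosetpreK _.
have sRC : R \subset C := sub_cosetpre _.
have sCP : C \subset P.
  by rewrite -(quotientGK nsRP) cosetpreSK -defPb char_sub.
have sCG := subset_trans sCP sPG; have pC := pgroupS sCP pP.
have nsRC : R <| C by rewrite /normal sRC (subset_trans sCG).
have nsCP : C <| P.
  by rewrite -[X in _ <| X](quotientGK nsRP) cosetpre_normal -defPb char_normal.
have ltNG : 'N_G(C) \proper G.
  rewrite properEneq subsetIl andbT; apply: contra ntC => /eqP NG.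
  have sCR : C \subset R by rewrite pcore_max // /normal sCG -{1}NG subsetIr.
  by rewrite -qC quotientS1.
suffices: p_nilpotent p 'N_(G / R)(Cb) by [].
have <- : 'N_G(C) / R = 'N_(G / R)(Cb) by rewrite -qC quotient_subnormG.
apply: p_nilpotent_quotient.
  by rewrite subIset // nRG.
apply: IH ltNG _; apply: (char_p_nilpotentS sylP) => //; last exact: subsetIl.
by rewrite subsetI sPG normal_norm.
Qed.

(** The case of Thompson's criterion that needs p odd. If O_p'(G / R) is not
   trivial, a Sylow subgroup Q of it is normalized by P / R, and E = Z(Q) is
   not trivial. If J = J(P) centralized E modulo R, then the preimage M of E
   would normalize J R, hence J, and M would be p-nilpotent; its p-complement
   centralizes R, so is trivial, and E would be a p-group. So one of the
   generators of J acts nontrivially on E, which abelem_offender_cent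
   excludes. *)
Lemma constrained_char_p_nilpotent (gT : finGroupType) (p : nat)
    (G : {group gT}) :
    odd p -> 'O_p^'(G) = 1 -> 'O_p(G) != 1 ->
    p_nilpotent p (G / 'O_p(G)) -> char_p_nilpotent p G ->
  p.-group G.
Proof.
move=> p_odd Op'G1 ntR0; set R := 'O_p(G)%G in ntR0 * => nilGR nilG.
have ntR : R :!=: 1 by [].
have nsRG : R <| G := pcore_normal p G; have [sRG nRG] := andP nsRG.
have pR : p.-group R := pcore_pgroup p G.
pose K := (coset R @*^-1 'O_p^'(G / R))%G.
have qK : K / R = 'O_p^'(G / R) := cosetpreK _.
have sCKR : 'C_K(R) \subset R := cent_pcore_sub_p'core Op'G1.
have [P sylP] := Sylow_exists p G; have [sPG pP _] := and3P sylP.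
have nRP := subset_trans sPG nRG; have sRP : R \subset P := pcore_sub_Hall sylP.
have ntP : P :!=: 1 by apply: contra ntR; rewrite -!subG1; apply: subset_trans.
have ntZ : 'Ohm_1('Z(P)) != 1.
  rewrite Ohm1_eq1; apply: contra ntP => /eqP Z1.
  by apply/eqP; apply: trivg_center_pgroup pP Z1.
have chZ : 'Ohm_1('Z(P)) \char P by rewrite !gFchar_trans.
have := cent_Ohm1_center_pcore Op'G1 nilGR sylP (nilG P _ sylP chZ ntZ).
rewrite -/R; pose V := 'Ohm_1('Z(R))%G => defCV.
have abelV : p.-abelem V.
  by rewrite Ohm1_abelem ?center_abelian // (pgroupS (center_sub R)).
have nVG : G \subset 'N(V).
  by apply: normal_norm; rewrite !gFnormal_trans.
have sVP : V \subset P.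
  by rewrite (subset_trans _ sRP) // (subset_trans (Ohm_sub 1 _)) ?center_sub.
have pPb : p.-group (P / R) := quotient_pgroup R pP.
have nKPb : P / R \subset 'N('O_p^'(G / R)).
  by rewrite (subset_trans (quotientS R sPG)) // gFnorm.
have p'Kb : p^'.-group 'O_p^'(G / R) := pcore_pgroup _ _.
have coKP : coprime #|'O_p^'(G / R)| #|P / R|.
  by rewrite coprime_sym (pnat_coprime pPb p'Kb).
have [K1 | [q q_pr q_dv]] := trivgVpdiv 'O_p^'(G / R).
  move: nilGR; rewrite /p_nilpotent K1 => pGR1.
  rewrite -(pquotient_pgroup pR nRG).
  by rewrite -(pquotient_pgroup (pgroup1 _ p) (norms1 _)).
have [Q sylQ nQP] := sol_coprime_Sylow_exists q (pgroup_sol pPb) nKPb coKP.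
have [sQK qQ _] := and3P sylQ.
pose E := 'Z(Q)%G; have sEQ : E \subset Q := center_sub Q.
have cEE : abelian E := center_abelian Q.
have sEK : E \subset 'O_p^'(G / R) := subset_trans sEQ sQK.
have p'E : p^'.-group E := pgroupS sEK p'Kb.
have sEG : E \subset G / R := subset_trans sEK (pcore_sub _ _).
have nEP : P / R \subset 'N(E) by rewrite gFnorm_trans.
have ntE : E :!=: 1.
  apply: contraL q_dv => /eqP Z1.
  have Q1 := trivg_center_pgroup qQ Z1.
  rewrite -p'natE // -partn_eq1 ?cardG_gt0 //.
  by rewrite -(card_Hall sylQ) Q1 cards1.
pose J := (Thompson_subgroup_group p P).
have sJP : J \subset P := Thompson_subgroup_sub p P.
have ntJ : J :!=: 1 := Thompson_subgroup_neq1 pP ntP.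
have chJ : J \char P := Thompson_subgroup_char p P.
have nRJ := subset_trans sJP nRP.
pose M := (coset R @*^-1 E)%G; have qM : M / R = E := cosetpreK _.
have sRM : R \subset M := sub_cosetpre _.
have sMK : M \subset K by rewrite cosetpreSK.
have sMG : M \subset G.
  by rewrite -(quotientGK nsRG) cosetpreSK.
have nRM := subset_trans sMG nRG.
have ncEJ : ~~ (J / R \subset 'C(E)).
  apply: contra ntE; rewrite -qM quotient_cents2 // => cJM.
  pose S := (J <*> R)%G.
  have defS : S = J * R :> {set gT} by apply: norm_joinEl.
  have sSP : S \subset P by rewrite join_subG sJP.
  have nSM : M \subset 'N(S).
    apply/subsetP=> m Mm; rewrite inE; apply/subsetP=> _ /imsetP[s Ss ->].
    move: Ss; rewrite defS => /mulsgP[j r Jj Rr ->].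
    rewrite conjMg -[j ^ m](mulKVg j) -commgEl -mulgA.
    apply: mem_mulg => //; rewrite groupM //.
      by rewrite (subsetP cJM) // mem_commg.
    by rewrite memJ_norm // (subsetP nRM).
  have nJM : M \subset 'N(J).
    have eJ : J = Thompson_subgroup_group p S.
      by apply/val_inj/esym/Thompson_subgroup_eq; rewrite // joing_subl.
    rewrite eJ; apply: char_norm_trans nSM; exact: Thompson_subgroup_char.
  have nilM : p_nilpotent p M.
    apply: p_nilpotentS (nilG P J sylP chJ ntJ).
    by rewrite subsetI sMG.
  have O1 : 'O_p^'(M) = 1.
    have sOR : 'O_p^'(M) \subset R.
      apply: subset_trans sCKR;
        rewrite subsetI (subset_trans (pcore_sub _ _)) //=.
      by apply: p_nilpotent_cent_pcore pR; rewrite /normal sRM.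
    apply/eqP; rewrite -subG1.
    have co := pnat_coprime pR (pcore_pgroup p^' M).
    by rewrite -(coprime_TIg co) subsetI sOR /=.
  have pM : p.-group M.
    move: nilM; rewrite /p_nilpotent O1.
    by rewrite pquotient_pgroup ?norms1 ?pgroup1.
  have pE : p.-group E by rewrite -qM quotient_pgroup.
  have /eqP := pnat_1 pE p'E.
  by rewrite -trivg_card1 -qM.
case/negP: ncEJ.
rewrite /quotient sub_morphim_pre // gen_subG; apply/bigcupsP=> A EA.
have sAP : A \subset P by have [] := pnElemP EA.
rewrite -sub_morphim_pre ?(subset_trans sAP) //.
apply: (abelem_offender_cent p_odd nsRG abelV nVG defCV pP sPG sVP EA) => //.
exact: subset_trans (quotientS R sAP) nEP.
Qed.

(** Quotients by O_p'(G) and O_p(G) reduce to the case where both are trivial.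
   If G then violates the criterion of Frobenius, let D be a nontrivial
   p-subgroup whose normalizer H is not p-nilpotent, with the p-part of |H|
   maximal, and let S be a Sylow p-subgroup of H.  If S is Sylow in G, then H
   inherits the hypothesis.  If not, then S grows in its normalizer, so the
   normalizers of the characteristic subgroups of S have a larger p-part than H,
   hence are p-nilpotent by the choice of D, and H satisfies the hypothesis as
   well.  But H < G since O_p(G) = 1. *)
Theorem Thompson_normal_p_complement (gT : finGroupType) (p : nat)
    (G : {group gT}) :
  odd p -> char_p_nilpotent p G -> p_nilpotent p G.
Proof.
move=> p_odd; have [n] := ubnP #|G|.
elim: n => // n IHn in gT G *; rewrite ltnS => leGn nilG.
have IHp (H : {group gT}) :
  H \proper G -> char_p_nilpotent p H -> p_nilpotent p H.
  by move=> ltHG; apply: IHn; apply: leq_trans (proper_card ltHG) leGn.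
have [Op'1 | ntOp'] := eqsVneq 'O_p^'(G) 1; last first.
  have nilGq : p_nilpotent p (G / 'O_p^'(G)).
    apply: IHn; last exact: char_p_nilpotent_p'quotient.
    exact: leq_trans (ltn_quotient ntOp' (pcore_sub _ _)) leGn.
  move: nilGq; rewrite /p_nilpotent trivg_pcore_quotient.
  by rewrite pquotient_pgroup ?norms1 ?pgroup1.
have [Op1 | ntOp] := eqsVneq 'O_p(G) 1; last first.
  have nilGq : p_nilpotent p (G / 'O_p(G)).
    apply: IHn; last exact: char_p_nilpotent_pcore_quotient.
    exact: leq_trans (ltn_quotient ntOp (pcore_sub _ _)) leGn.
  exact/quotient_pgroup/(constrained_char_p_nilpotent p_odd).
apply: Frobenius_normal_p_complement => // D0 sD0G pD0 ntD0.
pose bad := [pred D : {group gT} |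
  [&& D \subset G, p.-group D, D :!=: 1 & ~~ p_nilpotent p 'N_G(D)]].
apply: contraT => nnilD0; have badD0 : bad D0 by apply/and4P.
case: (arg_maxnP (fun D : {group gT} => (#|'N_G(D)|`_p)%N) badD0) => D.
move=> /and4P[sDG pD ntD nnilD] maxD; case/negP: (nnilD).
apply: IHp.
  rewrite properEneq subsetIl andbT; apply: contra ntD => /eqP NG.
  by rewrite -subG1 -Op1 pcore_max // /normal sDG -{1}NG subsetIr.
move=> S C sylS chC ntC; have [sSN pS _] := and3P sylS.
have sSG := subset_trans sSN (subsetIl _ _).
have [T sylT sST] := Sylow_superset sSG pS; have [sTG pT _] := and3P sylT.
have sCS := char_sub chC; have sCG := subset_trans sCS sSG.
apply: p_nilpotentS (setSI _ (subsetIl _ _)) _.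
apply: contraT => nnilC.
have badC : bad C by apply/and4P; split; rewrite // (pgroupS sCS).
have leC := maxD C badC.
have sNTC : 'N_T(S) \subset 'N_G(C).
  by rewrite setISS // (char_norms chC).
have eqST : S :=: T.
  apply: contraTeq leC => neqST; rewrite -ltnNge -(card_Hall sylS).
  have ltST : S \proper T by rewrite properEneq neqST.
  apply: leq_trans (proper_card (nilpotent_proper_norm (pgroup_nil pT) ltST)) _.
  have pNT : p.-group 'N_T(S) := pgroupS (subsetIl _ _) pT.
  rewrite -(part_pnat_id pNT); apply: dvdn_leq; rewrite ?part_gt0 //.
  exact: partn_dvd (cardG_gt0 _) (cardSg sNTC).
have sylSG : p.-Sylow(G) S by rewrite eqST.
by rewrite (nilG S C sylSG chC ntC) in nnilC.
Qed.

(** * Nilpotence of Frobenius kernels *)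

Section SumTrick.

Import FiniteModule GRing.Theory.
Local Notation "u ^@ x" := (actr u x) (at level 31, left associativity).

(** Work additively in M. The sum of u ^ a over a in A is fixed by A, so it
   vanishes; summing the conjugate relations over x in Q, the sum of all
   u ^ (a ^ x) vanishes as well. For a != 1 the map sending x to [~ a, x] permutes Q,
   so the elements a ^ x run over the coset a Q. What remains for a = 1 shows
   that |Q| u is the sum of u ^ y over y in Q, which is fixed by Q. *)
Lemma semiregular_fix_exp (gT : finGroupType) (M Q A : {group gT}) m :
    abelian M -> A \subset 'N(M) -> Q \subset 'N(M) -> A \subset 'N(Q) ->
    semiregular Q A -> 'C_M(A) = 1 -> m \in M ->
  m ^+ #|Q| \in 'C(Q).
Proof.
move=> cMM nMA nMQ nQA regA cMA Mm.
have [nMa nMx] := (subsetP nMA, subsetP nMQ).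
have nQa := subsetP nQA.
pose tau (u : fmod_of cMM) := (\sum_(y in Q) u ^@ y)%R.
have tauD u v : (tau (u + v) = tau u + tau v)%R.
  by rewrite /tau -big_split; apply: eq_bigr => y _; rewrite actAr.
have tau0 : tau 0%R = 0%R by rewrite /tau big1 // => y _; rewrite act0r.
have tau_fix u x : x \in Q -> (tau u ^@ x = tau u)%R.
  move=> Qx; rewrite [in RHS]/tau (reindex_inj (mulIg x)) /tau.
  rewrite (big_morph (fun w => w ^@ x) (@actAr _ _ cMM x) (@act0r _ _ cMM x)).
  by apply: eq_big => y; rewrite ?groupMr // => Qy; rewrite actrM ?nMx.
have sigma0 (u : fmod_of cMM) : (\sum_(a in A) u ^@ a = 0)%R.
  set s := (\sum_(a in A) _)%R.
  have sA a : a \in A -> (s ^@ a = s)%R.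
    move=> Aa; rewrite /s [in RHS](reindex_inj (mulIg a)).
    rewrite (big_morph (fun w => w ^@ a) (@actAr _ _ cMM a) (@act0r _ _ cMM a)).
    by apply: eq_big => y; rewrite ?groupMr // => Qy; rewrite actrM ?nMa.
  apply: val_inj; apply/set1gP; rewrite -cMA inE fmodP; apply/centP=> a Aa.
  by apply/commgP/conjg_fixP; rewrite -fmvalJ ?nMa // sA.
have sum_comm (u : fmod_of cMM) a : a \in A^# ->
    (\sum_(x in Q) u ^@ (a ^ x) = tau (u ^@ a))%R.
  case/setD1P=> nta Aa; rewrite /tau.
  pose h x := [~ a, x]; have hQ x : x \in Q -> h x \in Q.
    by move=> Qx; rewrite /h commgEr groupM // memJ_norm ?groupV ?nQa.
  have injh : {in Q &, injective h}.
    move=> x y Qx Qy /(mulgI a^-1) eq_axy.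
    have: x * y^-1 \in 'C_Q[a].
      rewrite inE groupM ?groupV //=;
        apply/cent1P/commute_sym/commgP/conjg_fixP.
      by rewrite conjgM eq_axy conjgK.
    rewrite regA; first by move/set1gP/(canRL (mulgKV y)); rewrite mul1g.
    by rewrite !inE nta.
  have {2}<- : h @: Q = Q.
    apply/eqP; rewrite eqEcard card_in_imset // leqnn andbT.
    by apply/subsetP=> _ /imsetP[x Qx ->]; apply: hQ.
  rewrite big_imset //=; apply: eq_bigr => x Qx.
  have nMh : h x \in 'N(M) by rewrite nMx ?hQ.
  have -> : a ^ x = a * h x by rewrite /h commgEl mulKVg.
  by have nMa1 := nMa a Aa; rewrite actrM.
have total : (\sum_(a in A) \sum_(x in Q) fmod cMM m ^@ (a ^ x) = 0)%R.
  rewrite exchange_big big1 //= => x Qx.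
  transitivity ((\sum_(a in A) fmod cMM m ^@ x^-1 ^@ a) ^@ x)%R.
    rewrite (big_morph (fun w => w ^@ x) (@actAr _ _ cMM x) (@act0r _ _ cMM x)).
    have nMx1 := nMx x Qx; apply: eq_bigr => a /nMa nMa1.
    by rewrite conjgE !actrM ?groupM ?groupV.
  by rewrite sigma0 act0r.
have Qm : (fmod cMM m *+ #|Q| = tau (fmod cMM m))%R.
  apply/eqP; rewrite -subr_eq0 -[X in _ == X]total (big_setD1 1) //=.
  have -> : (\sum_(x in Q) fmod cMM m ^@ (1 ^ x) = fmod cMM m *+ #|Q|)%R.
    by rewrite -sumr_const; apply: eq_bigr => x _; rewrite conj1g actr1.
  rewrite (eq_bigr (fun a => tau (fmod cMM m ^@ a))) => [|a];
    last exact: sum_comm.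
  rewrite -(big_morph tau tauD tau0); apply/eqP; congr (_ + _)%R.
  have := sigma0 (fmod cMM m); rewrite (big_setD1 1) //= actr1.
  move/eqP; rewrite addrC addr_eq0 => /eqP ->.
  by apply/eqP; rewrite eq_sym -addr_eq0 -tauD addNr tau0.
apply/centP=> x Qx; apply/commgP/conjg_fixP.
rewrite -(fmodK cMM Mm) -fmvalZ -fmvalJ ?nMx //; congr (val _).
by rewrite Qm tau_fix.
Qed.

End SumTrick.

Lemma nilpotent_p_nilpotent (gT : finGroupType) (p : nat) (G : {group gT}) :
  nilpotent G -> p_nilpotent p G.
Proof.
move=> nilG; have [_ _ p'iG] := and3P (nilpotent_pcore_Hall p^' nilG).
by rewrite pnatNK in p'iG; apply: p_nilpotent_intro p'iG;
  rewrite ?pcore_normal ?pcore_pgroup.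
Qed.

(** By induction it is enough that Z(N) is not trivial.  The complement is taken
   cyclic because a solvable group acting coprimely normalizes a Sylow
   p-subgroup for each p; conjugation in N then gives a complement that
   normalizes any prescribed one. *)
Lemma Frobenius_ker_nilpotent_cyclic (gT : finGroupType) (G N A : {group gT}) :
  cyclic A -> [Frobenius G = N ><| A] -> nilpotent N.
Proof.
have [n] := ubnP #|N|; elim: n => // n IHn in gT G N A *.
rewrite ltnS => leNn cycA frobG.
have [defG ntN ntA _ _] := Frobenius_context frobG.
have [nsNG sAG mulNA nNA tiNA] := sdprod_context defG.
have [sNG nNG] := andP nsNG; have coNA := Frobenius_coprime frobG.
have solA : solvable A := abelian_sol (cyclic_abelian cycA).
have IHsub (B M : {group gT}) : cyclic B -> [Frobenius G = N ><| B] ->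
  M \proper N -> B \subset 'N(M) -> nilpotent M.
  move=> cycB frobGB ltMN nMB.
  have [-> | ntM] := eqsVneq M 1; first exact: nilpotent1.
  have frobM := Frobenius_subl ntM (proper_sub ltMN) nMB frobGB.
  apply: IHn cycB frobM; exact: leq_trans (proper_card ltMN) leNn.
have IHquo (M : {group gT}) : M <| G -> M \proper N -> M :!=: 1 ->
  nilpotent (N / M).
  move=> nsMG ltMN ntM; have sMN := proper_sub ltMN.
  have frobGq : [Frobenius G / M = (N / M) ><| (A / M)].
    apply: Frobenius_coprime_quotient => //; split=> // x A1x.
    by rewrite (Frobenius_reg_ker frobG A1x) sub1G.
  apply: (IHn _ _ _ _ _ _ frobGq); last exact: quotient_cyclic.
  exact: leq_trans (ltn_quotient ntM sMN) leNn.
suffices ntZ : 'Z(N) != 1.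
  have [eqZN | ltZN] := eqVproper (center_sub N).
    by apply: abelian_nil; rewrite -eqZN center_abelian.
  rewrite -quotient_center_nil; apply: (IHquo 'Z(N)%G) => //.
  exact: gFnormal_trans.
have pZ (p : nat) : p.-group N -> 'Z(N) != 1.
  by move=> pN; apply: contraNneq ntN => /(trivg_center_pgroup pN) ->.
have [M minM sMN] : {M : {group gT} | minnormal M G & M \subset N}.
  by apply: mingroup_exists; rewrite ntN.
have [/andP[ntM nMG] minMG] := mingroupP minM.
have nMA := subset_trans sAG nMG.
have [eqMN | ltMN] := eqVproper sMN; last first.
  have nilM := IHsub A M cycA frobG ltMN nMA.
  have [_ _ /is_abelemP[p p_pr abelM]] :=
    minnormal_solvable minM (subxx M) (nilpotent_sol nilM).
  have [pM cMM _] := and3P abelM.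
  have nMN := subset_trans sNG nMG.
  have cMA : 'C_M(A) = 1.
    by apply/trivgP; rewrite -(Frobenius_trivg_cent frobG) setSI.
  have [P sylP] := Sylow_exists p N; have [sPN pP _] := and3P sylP.
  have sMP : M \subset P.
    by apply: subset_trans (pcore_sub_Hall sylP);
      rewrite pcore_max // /normal sMN.
  pose C := 'C_N(M)%G; have nsCN : C <| N.
    by rewrite /normal subsetIl normsI ?normG // norms_cent.
  have pNC : p.-nat #|N : C|.
    apply/pnatP=> // q q_pr q_dv; apply: contraLR q_dv => p'q.
    have [Q sylQ nQA] := sol_coprime_Sylow_exists q solA nNA coNA.
    have [sQN qQ q'NQ] := and3P sylQ.
    have regQ : semiregular Q A.
      exact: semiregularS sQN (subxx A) (Frobenius_reg_ker frobG).
    have coMQ : coprime #|M| #|Q|.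
      by rewrite (pnat_coprime pM) // (pi_pnat qQ).
    have cMQ : M \subset 'C(Q).
      apply/subsetP=> m Mm; rewrite -(expgK coMQ Mm) groupX //.
      exact: semiregular_fix_exp cMM nMA (subset_trans sQN nMN) nQA regQ cMA Mm.
    rewrite -p'natE //; apply: pnat_dvd q'NQ.
    by rewrite indexgS // subsetI sQN centsC.
  have defN : C * P = N.
    apply: coprime_index_mulG; rewrite ?subsetIl //.
    by apply: pnat_coprime pNC _; case/and3P: sylP.
  have /trivgPn[z /setIP[Mz /setIP[_ cPz]] ntz] : M :&: 'Z(P) != 1.
    by apply: (meet_center_nil (pgroup_nil pP));
      rewrite // /normal sMP (subset_trans sPN).
  apply/trivgPn; exists z => //;
    rewrite inE (subsetP sMN) //= -defN centM inE cPz.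
  by rewrite andbT; apply: (subsetP _ z Mz); rewrite centsC subsetIr.
have simpleN (C : {group gT}) : C <| G -> C \subset N -> C :!=: 1 -> C :=: N.
  move=> /andP[_ nCG] sCN ntC; rewrite -eqMN; apply: minMG; rewrite ?ntC //.
  by rewrite eqMN.
have [N2 | not2N] := boolP (2.-group N); first exact: pZ N2.
have [p [p_pr p_dv p_odd]] : exists p, [/\ prime p, p %| #|N| & odd p].
  rewrite -(pgroupNK 2) -partG_eq1 in not2N; set m := (#|N|`_2^')%N in not2N.
  have m_gt1 : 1 < m by rewrite ltn_neqAle eq_sym not2N part_gt0.
  have [p_pr p_dv] := (pdiv_prime m_gt1, pdiv_dvd m).
  exists (pdiv m); split=> //; first exact: dvdn_trans p_dv (dvdn_part _ _).
  have := pnatP _ (ltnW m_gt1) (part_pnat _ _) (pdiv m) p_pr p_dv.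
  by rewrite !inE; case: (even_prime p_pr) => // ->.
have [pN | not_pN] := boolP (p.-group N); first exact: pZ pN.
have nilpN : p_nilpotent p N.
  apply: Thompson_normal_p_complement => // P C sylP chC ntC.
  have [P0 sylP0 nP0A] := sol_coprime_Sylow_exists p solA nNA coNA.
  have [x Nx defP] := Sylow_trans sylP0 sylP.
  have [Gx [sPN pP _]] := (subsetP sNG x Nx, and3P sylP).
  pose B := (A :^ x)%G; have frobB : [Frobenius G = N ><| B].
    by have := FrobeniusJ x G N A;
      rewrite (conjGid Gx) (conjGid Nx) frobG => ->.
  have nPB : B \subset 'N(P) by rewrite defP normJ conjSg.
  have nCB : B \subset 'N(C) := char_norm_trans chC nPB.
  have sCN := subset_trans (char_sub chC) sPN.
  have nilNC : 'N_N(C) \proper N -> nilpotent 'N_N(C).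
    move=> ltN; apply: (IHsub B _ _ frobB ltN); rewrite ?cyclicJ //.
    rewrite normsI ?norms_norm //; apply: subset_trans nNG.
    by rewrite -(conjGid Gx) conjSg.
  have [eqNN | ltNN] := eqVproper (subsetIl N 'N(C)).
    have [/sdprodW mulNB _ _ _ _] := Frobenius_context frobB.
    have nsCG : C <| G.
      by rewrite /normal (subset_trans sCN) // -mulNB mul_subG // -eqNN
        subsetIr.
    by case/negP: not_pN; rewrite -(simpleN C) ?(pgroupS (char_sub chC)).
  exact/nilpotent_p_nilpotent/nilNC.
case/negP: not_pN; have [K1 | ntK] := eqsVneq 'O_p^'(N) 1.
  by move: nilpN; rewrite /p_nilpotent K1 pquotient_pgroup ?norms1 ?pgroup1.
have eqKN : 'O_p^'(N) = N.
  by apply: (simpleN 'O_p^'(N)%G) => //; rewrite ?gFnormal_trans ?pcore_sub.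
have := pcore_pgroup p^' N; rewrite eqKN => p'N.
by have := pgroupP p'N p p_pr p_dv; rewrite !inE eqxx.
Qed.

Theorem Frobenius_ker_nilpotent (gT : finGroupType) (G N A : {group gT}) :
  [Frobenius G = N ><| A] -> nilpotent N.
Proof.
move=> frobG; have [_ _ ntA _ _] := Frobenius_context frobG.
have [a Aa nta] := trivgPn _ ntA.
apply: (Frobenius_ker_nilpotent_cyclic (cycle_cyclic a)).
by apply: Frobenius_subr frobG; rewrite ?cycle_eq1 ?cycle_subG.
Qed.

(** The complement acts semiregularly on the nontrivial center. *)
Lemma Frobenius_compl_ltn_center (gT : finGroupType) (G N A : {group gT}) :
  [Frobenius G = N ><| A] -> #|A| < #|'Z(N)|.
Proof.
move=> frobG; have [_ ntN _ _ _] := Frobenius_context frobG.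
have [defG _ _ _ _] := Frobenius_context frobG.
have [_ _ _ nNA _] := sdprod_context defG.
have ntZ : 'Z(N) != 1.
  by rewrite center_nil_eq1 // (Frobenius_ker_nilpotent frobG).
have nZA : A \subset 'N('Z(N)) by rewrite gFnorm_trans.
have := Frobenius_dvd_ker1 (Frobenius_subl ntZ (center_sub N) nZA frobG).
move=> /dvdn_leq; rewrite -!subn1 subn_gt0 cardG_gt1 => /(_ ntZ).
by rewrite leq_subRL ?add1n ?cardG_gt0.
Qed.

(** * The Chermak-Delgado lattice of a Frobenius group *)

Lemma cd_measure_le_max (gT : finGroupType)
    (K H : {group gT}) : H \subset K -> cd_measure K H <= cd_max K.
Proof. by move=> sHK; apply: (leq_bigmax_cond _ sHK). Qed.

Lemma cd_measureS (gT : finGroupType) (K L H : {group gT}) :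
  K \subset L -> cd_measure K H <= cd_measure L H.
Proof. by move=> sKL; rewrite leq_mul // subset_leq_card // setSI. Qed.

Section FrobeniusCD.

Variables (gT : finGroupType) (G N A : {group gT}).
Hypothesis frobG : [Frobenius G = N ><| A].
Implicit Types H K : {group gT}.

Lemma Frobenius_cent_sub_ker H : H \subset N -> H :!=: 1 -> 'C_G(H) \subset N.
Proof.
move=> sHN /trivgPn[x Hx ntx];
  apply: subset_trans (Frobenius_cent1_ker frobG (x := x) _).
  by rewrite setIS // -cent_set1 centS // sub1set.
by rewrite !inE ntx (subsetP sHN).
Qed.

(** A nontrivial element of N that centralizes H has H in its centralizer, which
   lies in N. *)
Lemma Frobenius_cent_TI_ker H : H \subset G -> ~~ (H \subset N) ->
  'C_G(H) :&: N = 1.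
Proof.
move=> sHG; apply: contraNeq => /trivgPn[x /setIP[/setIP[Gx cHx] Nx] ntx].
have N1x : x \in N^# by rewrite !inE ntx.
apply: subset_trans (Frobenius_cent1_ker frobG N1x).
by rewrite subsetI sHG sub_cent1.
Qed.

Lemma Frobenius_TI_ker_card H : H \subset G -> H :&: N = 1 -> #|H| <= #|A|.
Proof.
move=> sHG tiHN; have [defG ntN _ _ _] := Frobenius_context frobG.
have [nsNG _ _ _ _] := sdprod_context defG; have [sNG _] := andP nsNG.
rewrite -(leq_pmul2r (cardG_gt0 N)) -(TI_cardMg tiHN) mulnC (sdprod_card defG).
by rewrite subset_leq_card // mul_subG.
Qed.

(** Both m_G(1) = |G| and the measures of the subgroups outside N fall below
   m_N(N) = |N||Z(N)|, because |A| < |Z(N)|. *)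
Lemma Frobenius_cd_measure_ltn_max H :
  H \subset G -> ~~ ((H \subset N) && (H :!=: 1)) -> cd_measure G H < cd_max N.
Proof.
move=> sHG nH; have ltAZ := Frobenius_compl_ltn_center frobG.
have [defG ntN ntA _ _] := Frobenius_context frobG.
have oG : (#|N| * #|A|)%N = #|G| := sdprod_card defG.
have ltGN : #|G| < cd_max N.
  apply: leq_trans (cd_measure_le_max (subxx N)).
  by rewrite -oG ltn_pmul2l ?cardG_gt0.
have [H1 | ntH] := eqsVneq H 1.
  by rewrite /cd_measure H1 cards1 mul1n (leq_ltn_trans _ ltGN) //
    subset_leq_card ?subsetIl.
rewrite ntH andbT in nH; have tiCN := Frobenius_cent_TI_ker sHG nH.
apply: leq_ltn_trans ltGN; rewrite /cd_measure.
have [-> | ntC] := eqsVneq 'C_G(H) 1;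
  first by rewrite cards1 muln1 subset_leq_card.
have sCG : 'C_G(H) \subset G by apply: subsetIl.
have nCN : ~~ ('C_G(H) \subset N).
  by apply: contra ntC => sCN; rewrite -tiCN (setIidPl sCN).
have tiHN : H :&: N = 1.
  apply/trivgP; rewrite -(Frobenius_cent_TI_ker sCG nCN) setSI // subsetI sHG.
  by rewrite centsC subsetIr.
rewrite -oG leq_mul ?Frobenius_TI_ker_card //.
apply: leq_trans (Frobenius_TI_ker_card sHG tiHN) _.
apply: leq_trans (ltnW ltAZ) _; exact: subset_leq_card (center_sub N).
Qed.

Lemma Frobenius_cd_measure_ker H : H \subset N -> H :!=: 1 ->
  cd_measure G H = cd_measure N H.
Proof.
move=> sHN ntH; have [defG _ _ _ _] := Frobenius_context frobG.
have [/andP[sNG _] _ _ _ _] := sdprod_context defG.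
suffices eqC : 'C_G(H) = 'C_N(H) by rewrite /cd_measure eqC.
apply/eqP; rewrite eqEsubset (setSI _ sNG) andbT.
by rewrite subsetI subsetIr Frobenius_cent_sub_ker.
Qed.

Lemma Frobenius_cd_max : cd_max G = cd_max N.
Proof.
have [defG ntN _ _ _] := Frobenius_context frobG.
have [/andP[sNG _] _ _ _ _] := sdprod_context defG.
apply/eqP; rewrite eqn_leq; apply/andP; split; apply/bigmax_leqP=> H sH.
  have [/andP[sHN ntH] | nH] := boolP ((H \subset N) && (H :!=: 1)).
    by rewrite Frobenius_cd_measure_ker // cd_measure_le_max.
  exact: ltnW (Frobenius_cd_measure_ltn_max sH nH).
apply: leq_trans (cd_measure_le_max (subset_trans sH sNG)).
exact: cd_measureS.
Qed.

End FrobeniusCD.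

Theorem theorem6 (gT : finGroupType) (G N A : {group gT})
    (frobG : [Frobenius G = N ><| A]) :
  cd_lattice G = cd_lattice N.
Proof.
have [defG ntN _ _ _] := Frobenius_context frobG.
have [/andP[sNG _] _ _ _ _] := sdprod_context defG.
apply/setP=> H; rewrite !inE (Frobenius_cd_max frobG).
have [/andP[sHN ntH] | nH] := boolP ((H \subset N) && (H :!=: 1)).
  by rewrite sHN (subset_trans sHN sNG) (Frobenius_cd_measure_ker frobG).
have [sHG | nHG] := boolP (H \subset G); last first.
  apply/esym/negbTE; apply: contra nHG => /andP[sHN _].
  exact: subset_trans sNG.
have ltH := Frobenius_cd_measure_ltn_max frobG sHG nH; rewrite (ltn_eqF ltH) /=.
apply/esym/negbTE; apply: contraL ltH => /andP[_ /eqP <-].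
by rewrite -leqNgt cd_measureS.
Qed.
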